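(* Let $R = k[x_1,\dots,x_n]$ be a polynomial ring over a field $k$. Let $I$ be a monomial ideal in $R$ and let $f$ be an arbitrary monomial in $R$. Then (i) $\operatorname{depth} R/I \in \{\operatorname{depth} R/(I:f),\ \operatorname{depth} R/(I,f)\}$; (ii) $\operatorname{depth} R/I = \operatorname{depth} R/(I:f)$ if $\operatorname{depth} R/(I,f) \ge \operatorname{depth} R/(I:f)$.
   Context: $R$ has the standard grading and $\mathfrak m=(x_1,\dots,x_n)$. For a finitely generated graded $R$-module $M$ with local cohomology modules $H^i_{\mathfrak m}(M)$, $\operatorname{depth} M := \min\{ i \mid H^i_{\mathfrak m}(M) \neq 0\}$. By the usual convention the zero module has depth $+\infty$. $I:f=\{g\in R\mid gf\in I\}$ and $(I,f)=I+(f)$. *)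

(* Defs.v *)
From HB Require Import structures.
From mathcomp Require Import all_boot all_order all_algebra.
From mathcomp Require Import generic_quotient ring_quotient.
From mathcomp Require Import mpoly zify.
From mathcomp Require Import boolp.

Set Implicit Arguments.
Unset Strict Implicit.
Unset Printing Implicit Defensive.

Import GRing.Theory.
Local Open Scope ring_scope.
Local Open Scope quotient_scope.

(* Unlike [idealr] of ring_quotient, ideals here may be the whole ring. *)
HB.mixin Record isMulAbsorbing (R : comNzRingType) (S : R -> bool) := {
  ideal_mulr_subproof : forall a u : R, u \in S -> a * u \in S
}.

#[short(type="ideal")]
HB.structure Definition Ideal (R : comNzRingType) :=
  {S of GRing.ZmodClosed R S & isMulAbsorbing R S}.

Lemma ideal_mulr (R : comNzRingType) (I : ideal R) (a u : R) :
  u \in I -> a * u \in I.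
Proof. exact: ideal_mulr_subproof. Qed.

Section ColonAndSum.
Variables (R : comNzRingType) (I : ideal R) (f : R).

Definition colon_pred : R -> bool := fun g => g * f \in I.

Lemma colon_predE g : (g \in colon_pred) = (g * f \in I).
Proof. by []. Qed.

Fact colon_zmod_closed : zmod_closed colon_pred.
Proof.
split=> [|g h]; rewrite !colon_predE ?mul0r ?rpred0 // => Ig Ih.
by rewrite mulrBl rpredB.
Qed.
HB.instance Definition _ := GRing.isZmodClosed.Build R colon_pred
  colon_zmod_closed.

Fact colon_mulr (a u : R) : u \in colon_pred -> a * u \in colon_pred.
Proof. by rewrite !colon_predE -mulrA; apply: ideal_mulr. Qed.
HB.instance Definition _ := isMulAbsorbing.Build R colon_pred colon_mulr.

Definition colon : ideal R := [the ideal R of colon_pred : {pred R}].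

Definition adjoin_pred : R -> bool :=
  fun g => `[< exists2 h, h \in I & exists r, g = h + r * f >].

Fact adjoin_zmod_closed : zmod_closed adjoin_pred.
Proof.
split=> [|g h].
  apply/asboolP; exists 0; first exact: rpred0.
  by exists 0; rewrite mul0r addr0.
move=> /asboolP[g' Ig' [r ->]] /asboolP[h' Ih' [s ->]].
apply/asboolP; exists (g' - h'); first by rewrite rpredB.
by exists (r - s); rewrite mulrBl opprD addrACA.
Qed.
HB.instance Definition _ := GRing.isZmodClosed.Build R adjoin_pred
  adjoin_zmod_closed.

Fact adjoin_mulr (a u : R) : u \in adjoin_pred -> a * u \in adjoin_pred.
Proof.
move=> /asboolP[u' Iu' [r ->]]; apply/asboolP.
exists (a * u'); first exact: ideal_mulr.
by exists (a * r); rewrite mulrDr mulrA.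
Qed.
HB.instance Definition _ := isMulAbsorbing.Build R adjoin_pred adjoin_mulr.

Definition adjoin : ideal R := [the ideal R of adjoin_pred : {pred R}].

End ColonAndSum.

Definition generated_by (R : comNzRingType) (G : R -> Prop) (I : ideal R) :=
  forall g : R, g \in I <->
    exists s : seq (R * R),
      (forall p, p \in s -> G p.2) /\ g = \sum_(p <- s) p.1 * p.2.

Definition monomial_ideal (k : fieldType) (n : nat) (I : ideal {mpoly k[n]}) :=
  exists A : 'X_{1..n} -> Prop,
    generated_by (fun g => exists2 m, A m & g = 'X_[m]) I.

Definition quotmod (R : comNzRingType) (I : ideal R) : Type :=
  Quotient.quot I.

Section QuotientModule.
Variables (R : comNzRingType) (I : ideal R).
Local Notation Q := (quotmod I).

HB.instance Definition _ := GRing.Zmodule.on Q.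

Definition quotmod_scale (a : R) (x : Q) : Q := \pi_Q (a * repr x).

Lemma quotmod_eqP (x y : R) :
  reflect (\pi_Q x = \pi_Q y) (x - y \in I).
Proof. by rewrite (Quotient.idealrBE I); apply: eqP. Qed.

Lemma quotmod_piD (x y : R) : \pi_Q (x + y) = \pi_Q x + \pi_Q y.
Proof. by rewrite [RHS]piE. Qed.

Lemma quotmod_pi_scale (a x : R) : quotmod_scale a (\pi_Q x) = \pi_Q (a * x).
Proof.
by apply/quotmod_eqP; rewrite -mulrBr ideal_mulr //; apply/quotmod_eqP; rewrite reprK.
Qed.

Fact quotmod_scaleA a b (x : Q) :
  quotmod_scale a (quotmod_scale b x) = quotmod_scale (a * b) x.
Proof.
elim/quotW: x => x.
by rewrite (quotmod_pi_scale b) (quotmod_pi_scale a) quotmod_pi_scale mulrA.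
Qed.

Fact quotmod_scale1 : left_id 1 quotmod_scale.
Proof. by elim/quotW=> x; rewrite quotmod_pi_scale mul1r. Qed.

Fact quotmod_scaleDr : right_distributive quotmod_scale +%R.
Proof.
move=> a; elim/quotW=> x; elim/quotW=> y.
by rewrite -quotmod_piD !quotmod_pi_scale mulrDr quotmod_piD.
Qed.

Fact quotmod_scaleDl (x : Q) : {morph quotmod_scale^~ x : a b / a + b}.
Proof.
elim/quotW: x => x a b.
by rewrite /= !quotmod_pi_scale mulrDl quotmod_piD.
Qed.

HB.instance Definition _ := GRing.Zmodule_isLmodule.Build R Q
  quotmod_scaleA quotmod_scale1 quotmod_scaleDr quotmod_scaleDl.

End QuotientModule.

(* The localization M_g of M at the powers of g: the pair (m, s) encodes the
   fraction m / g ^ s. *)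
Section Localization.
Variables (R : comNzRingType) (M : lmodType R) (g : R).
Implicit Types p q r : M * nat.

Definition loc_equiv p q : bool :=
  `[< exists u, g ^+ (u + q.2) *: p.1 = g ^+ (u + p.2) *: q.1 >].

Lemma loc_equivP p q :
  reflect (exists u, forall v w, (v + p.2 = w + q.2)%N -> (u + q.2 <= v)%N ->
             g ^+ v *: p.1 = g ^+ w *: q.1)
          (loc_equiv p q).
Proof.
rewrite /loc_equiv; apply: (iffP (asboolP _)) => -[u e]; last first.
  by exists u; apply: e; rewrite ?leqnn // addnAC.
exists u => v w evw le_v.
have -> : (v = (v - (u + q.2)) + (u + q.2))%N by lia.
have -> : (w = (v - (u + q.2)) + (u + p.2))%N by lia.
by rewrite (exprD g _ (u + q.2)) (exprD g _ (u + p.2)) -!scalerA e.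
Qed.

Fact loc_equiv_class : equiv_class_of loc_equiv.
Proof.
split=> [p|p q|q p r]; first by apply/asboolP; exists 0%N.
  by apply/asboolP/asboolP=> -[u e]; exists u.
move=> /loc_equivP[u e] /loc_equivP[v e']; apply/asboolP.
exists (u + v + q.2)%N.
rewrite (e _ (u + v + p.2 + r.2)%N); [|lia|lia].
by apply: e'; lia.
Qed.

Canonical loc_equiv_equiv := EquivRelPack loc_equiv_class.
Canonical loc_encModRel := defaultEncModRel loc_equiv.

Definition loc := {eq_quot loc_equiv}.
HB.instance Definition _ := Choice.on loc.
HB.instance Definition _ := EqQuotient.on loc.

Lemma loc_eqP p q : reflect (\pi_loc p = \pi_loc q) (loc_equiv p q).
Proof. by rewrite -[loc_equiv p q]eqmodE; apply: eqP. Qed.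

Definition frac_add p q : M * nat :=
  (g ^+ q.2 *: p.1 + g ^+ p.2 *: q.1, (p.2 + q.2)%N).

Definition loc_zero : loc := \pi_loc (0, 0%N).
Definition loc_opp (x : loc) : loc := \pi_loc (- (repr x).1, (repr x).2).
Definition loc_add (x y : loc) : loc := \pi_loc (frac_add (repr x) (repr y)).

Lemma loc_repr p : exists u, forall v w,
  (v + (repr (\pi_loc p)).2 = w + p.2)%N -> (u <= v)%N ->
  g ^+ v *: (repr (\pi_loc p)).1 = g ^+ w *: p.1.
Proof.
have /loc_equivP[u e] : loc_equiv (repr (\pi_loc p)) p by apply/loc_eqP; rewrite reprK.
by exists (u + p.2)%N.
Qed.

Lemma loc_oppE p : loc_opp (\pi_loc p) = \pi_loc (- p.1, p.2).
Proof.
rewrite /loc_opp; case: (loc_repr p) => u; set q := repr _ => e.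
apply/loc_eqP/asboolP; exists u => /=; rewrite !scalerN (e _ (u + q.2)%N) //.
  by rewrite addnAC.
exact: leq_addr.
Qed.

Lemma loc_addE p q : loc_add (\pi_loc p) (\pi_loc q) = \pi_loc (frac_add p q).
Proof.
rewrite /loc_add; case: (loc_repr p) => u; set p' := repr _ => ep.
case: (loc_repr q) => v; set q' := repr _ => eq.
apply/loc_eqP/asboolP; exists (u + v)%N => /=.
rewrite !scalerDr !scalerA -!exprD.
congr (_ + _); [rewrite (ep _ (u + v + (p'.2 + q'.2) + q.2)%N)|
                rewrite (eq _ (u + v + (p'.2 + q'.2) + p.2)%N)] => //; lia.
Qed.

Fact loc_addA : associative loc_add.
Proof.
elim/quotW=> x; elim/quotW=> y; elim/quotW=> z.
rewrite (loc_addE y z) (loc_addE x y) (loc_addE x) (loc_addE _ z).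
congr \pi_loc; rewrite /frac_add /= !scalerDr !scalerA -!exprD !addrA addnA.
by rewrite (addnC z.2 y.2) (addnC z.2 x.2).
Qed.

Fact loc_addC : commutative loc_add.
Proof.
elim/quotW=> x; elim/quotW=> y; rewrite (loc_addE x y) (loc_addE y x).
by rewrite /frac_add addrC addnC.
Qed.

Fact loc_add0 : left_id loc_zero loc_add.
Proof.
elim/quotW=> -[m s]; rewrite (loc_addE (0, 0%N) (m, s)).
by rewrite /frac_add /= scaler0 add0r expr0 scale1r add0n.
Qed.

Fact loc_addN : left_inverse loc_zero loc_opp loc_add.
Proof.
elim/quotW=> x; rewrite (loc_oppE x) (loc_addE (- x.1, x.2) x).
apply/loc_eqP/asboolP; exists 0%N.
by rewrite /frac_add /= scalerN addNr !scaler0.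
Qed.

HB.instance Definition _ :=
  GRing.isZmodule.Build loc loc_addA loc_addC loc_add0 loc_addN.

Lemma loc_piD p q : \pi_loc p + \pi_loc q = \pi_loc (frac_add p q).
Proof. exact: loc_addE. Qed.

Lemma loc_piN p : - \pi_loc p = \pi_loc (- p.1, p.2).
Proof. exact: loc_oppE. Qed.

End Localization.

Arguments loc {R} M g.

(* The canonical map M_g -> M_g', m / g ^ s |-> h ^ s *: m / g' ^ s, which is
   meaningful when g' = h * g. *)
Definition loc_map (R : comNzRingType) (M : lmodType R) (g g' h : R)
    (x : loc M g) : loc M g' :=
  \pi_(loc M g') (h ^+ (repr x).2 *: (repr x).1, (repr x).2).

Lemma loc_mapE (R : comNzRingType) (M : lmodType R) (g g' h : R) m s :
  g' = h * g ->
  loc_map g' h (\pi_(loc M g) (m, s)) = \pi_(loc M g') (h ^+ s *: m, s).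
Proof.
move=> ->; rewrite /loc_map; case: (loc_repr g (m, s)) => u.
set q := repr _ => /= e; apply/loc_eqP/asboolP; exists u => /=.
rewrite !scalerA !exprMn !(mulrAC _ (g ^+ _)) -!exprD.
rewrite -!scalerA (e _ (u + q.2)%N) ?leq_addr 1?addnAC //.
Qed.

(* Local cohomology with support in (x_1, ..., x_n), as the cohomology of the
   Cech complex with C^i = \prod_(#|F| = i) M_{x_F}, x_F = \prod_(j in F) x_j.
   A cochain carries components at all F; those with #|F| = i form C^i. *)
Section LocalCohomology.
Variables (n : nat) (k : fieldType) (M : lmodType {mpoly k[n]}).
Implicit Types (F : {set 'I_n}) (i : nat).

Definition xprod F : {mpoly k[n]} := \prod_(j in F) 'X_j.

Definition cochain := forall F, loc M (xprod F).

Definition cech_d (c : cochain) : cochain := fun F =>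
  \sum_(j in F)
    loc_map (xprod F) 'X_j (c (F :\ j)) *~ (-1) ^+ #|[set l in F | (l < j)%N]|.

Definition cocycle i (c : cochain) := forall F, #|F| = i.+1 -> cech_d c F = 0.

(* For i = 0 the condition reads c set0 = 0, since cech_d b set0 = 0. *)
Definition coboundary i (c : cochain) :=
  exists b : cochain, forall F, #|F| = i -> c F = cech_d b F.

(* H^i_m(M) <> 0 *)
Definition local_cohomology_neq0 i : Prop :=
  exists c : cochain, cocycle i c /\ ~ coboundary i c.

(* None stands for +oo. *)
Definition depth : option nat :=
  if pselect (exists i, `[< local_cohomology_neq0 i >]) is left H
  then Some (ex_minn H) else None.

End LocalCohomology.

Definition depth_le (d e : option nat) : Prop :=
  match d, e with
  | _, None => True
  | None, Some _ => False
  | Some a, Some b => (a <= b)%N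
  end.

(* Main.v *)
Require Import Defs.
From HB Require Import structures.
From mathcomp Require Import all_boot all_order all_algebra.
From mathcomp Require Import generic_quotient ring_quotient.
From mathcomp Require Import mpoly zify ring.
From mathcomp Require Import boolp.

(** Write J for I : f and L for (I, f), and call a module vanishing in degree i
    when its i-th local cohomology is zero. From 0 -> R/J -> R/I -> R/L -> 0 one
    gets that vanishing of R/J and R/L in degree i gives that of R/I
    ([vanishing_middle]), and that vanishing of R/I in degree i and of R/J in
    degree i + 1 gives that of R/L in degree i ([vanishing_adjoin]). What is
    special to monomials is that vanishing of R/I in degree i forces that of R/J
    in the same degree ([vanishing_colon]); hence depth R/I <= depth R/J. If the
    inequality is strict, the two consequences of the exact sequence force
    depth R/L = depth R/I < depth R/J, which is everything that is claimed
    ([first_failure_colon]).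

    All three facts are proved one multidegree at a time. The Cech complex of
    R/I is graded by Z^n, and its part of degree a is combinatorial: the
    component at a set F of variables is one copy of k or zero, according to
    whether x^a survives in the localization of R/I at x_F. So this part is the
    complex of k-valued functions on a family S of faces F, with the usual signed
    differential of the simplex, and the local cohomology of R/I vanishes in
    degree i if and only if all these complexes are exact there
    ([cech_acyclicP]).

    A degree a is written as u - N(1,...,1) with u a monomial exponent and N a
    natural number; then S = [degree_support u N] consists of the F such that
    a >= 0 off F and no monomial which agrees with a off F lies in I. Only the
    signs of the a_j and the values of the nonnegative ones matter to S, and the
    family of J at a is the family of I at a', where a' = a + deg f at the
    coordinates at which a >= 0 and a' = a elsewhere
    ([colon_degree_support]): this is [vanishing_colon]. Moreover the family of
    I at a is the disjoint union of that of L at a and that of J at a - deg f,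
    the latter being closed upwards, so that [acyclic_middle] and
    [acyclic_quotient], a piece of the long exact sequence for functions on
    families of faces, give the other two. *)

Set Implicit Arguments.
Unset Strict Implicit.
Unset Printing Implicit Defensive.

Import GRing.Theory.
Local Open Scope ring_scope.
Local Open Scope quotient_scope.

(** * Functions on families of faces *)

Section SimplexComplex.
Variables (n : nat) (V : zmodType).
Implicit Types (F G : {set 'I_n}) (j l : 'I_n) (S : {set 'I_n} -> bool).
Implicit Types (c b : {set 'I_n} -> V).

Definition face_sign F j : int := (-1) ^+ #|[set l in F | (l < j)%N]|.

Definition simplex_d c F : V := \sum_(j in F) c (F :\ j) *~ face_sign F j.

Lemma eq_simplex_d c b F :
  (forall j, j \in F -> c (F :\ j) = b (F :\ j)) -> simplex_d c F = simplex_d b F.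
Proof. by move=> e; apply: eq_bigr => j jF; rewrite e. Qed.

Lemma simplex_d_eq0 c F :
  (forall j, j \in F -> c (F :\ j) = 0) -> simplex_d c F = 0.
Proof. by move=> e; apply: big1 => j jF; rewrite e ?mul0rz. Qed.

Lemma simplex_dD c b F :
  simplex_d (fun G => c G + b G) F = simplex_d c F + simplex_d b F.
Proof. by rewrite -big_split; apply: eq_bigr => j _; rewrite mulrzDl. Qed.

Lemma simplex_dB c b F :
  simplex_d (fun G => c G - b G) F = simplex_d c F - simplex_d b F.
Proof. by rewrite -sumrB; apply: eq_bigr => j _; rewrite mulrzBl. Qed.

(** Removing the smaller element l first makes the position of j drop by one,
    while removing j first does not affect the position of l. *)
Lemma face_sign_swap F j l : j \in F -> l \in F -> (l < j)%N ->
  face_sign (F :\ j) l * face_sign F j = - (face_sign (F :\ l) j * face_sign F l).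
Proof.
move=> jF lF lj; rewrite /face_sign.
have -> : [set t in F :\ j | (t < l)%N] = [set t in F | (t < l)%N].
  apply/setP=> t; rewrite !inE; case: eqP => [->|//] /=.
  by rewrite ltnNge (ltnW lj) andbF.
have -> : [set t in F :\ l | (t < j)%N] = [set t in F | (t < j)%N] :\ l.
  by apply/setP=> t; rewrite !inE andbA.
rewrite (cardsD1 l [set t in F | (t < j)%N]) !inE lF lj /= add1n exprS.
by rewrite mulN1r mulrN mulrC.
Qed.

(** The terms that remove {j, l} in the two possible orders cancel; the double
    sum is split according to whether the larger or the smaller one is removed
    first, so that no division by 2 is involved. *)
Lemma simplex_dd c F : simplex_d (simplex_d c) F = 0.
Proof.
pose a j l := c (F :\ j :\ l) *~ (face_sign (F :\ j) l * face_sign F j).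
pose A (r : rel 'I_n) := \sum_(j in F) \sum_(l in F | r l j) a j l.
have -> : simplex_d (simplex_d c) F =
    A (fun l j => (l < j)%N) + A (fun l j => (j < l)%N).
  rewrite -big_split; apply: eq_bigr => j jF /=.
  rewrite /simplex_d mulrz_suml.
  rewrite [LHS](bigID (fun l => (l < j)%N)) /=.
  congr (_ + _); apply: eq_big => [l|l _]; rewrite /a ?mulrzA // !inE.
    by case: (l =P j) => [->|]; rewrite ?ltnn ?andbF.
  by rewrite -leqNgt [(j < l)%N]ltn_neqAle val_eqE (eq_sym l) andbAC andbC andbA.
rewrite /A [X in _ + X](exchange_big_dep (fun l => l \in F)) /=; last first.
  by move=> j l _ /andP[].
rewrite -big_split big1 //= => j jF.
under [X in _ + X]eq_bigl => l do rewrite jF /=.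
rewrite -big_split big1 //= => l /andP[lF lj].
by rewrite /a face_sign_swap // mulrNz setDDl setUC -setDDl addNr.
Qed.

Definition supported S c := forall F, ~~ S F -> c F = 0.

(** Functions supported on S form a complex when S is convex: the differential is
    that of the simplex, with its values outside S discarded. For this reason
    both equations are only asked on S. *)
Definition acyclic S i := forall c, supported S c ->
  (forall F, S F -> #|F| = i.+1 -> simplex_d c F = 0) ->
  exists2 b, supported S b & forall F, S F -> #|F| = i -> c F = simplex_d b F.

Lemma eq_acyclic S S' i : S =1 S' -> acyclic S i -> acyclic S' i.
Proof. by move=> /funext->. Qed.

Definition convex S := forall F j l,
  S F -> S (F :\ j :\ l) -> S (F :\ j).

Definition truncate S c F := if S F then c F else 0.

Lemma truncateT S c F : S F -> truncate S c F = c F.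
Proof. by rewrite /truncate => ->. Qed.

Lemma truncate_supported S c : supported S (truncate S c).
Proof. by move=> F; rewrite /truncate => /negbTE->. Qed.

(** Discarding the values of dc outside S does not spoil dd = 0: at a facet of
    F in S which is outside S, convexity makes dc vanish already. *)
Lemma simplex_d_truncate S c F : convex S -> supported S c -> S F ->
  simplex_d (truncate S (simplex_d c)) F = 0.
Proof.
move=> cS sc SF; rewrite -(simplex_dd c F); apply: eq_simplex_d => j jF.
rewrite /truncate; case: ifPn => // NS; rewrite simplex_d_eq0 // => l _.
by apply: sc; apply: contra NS; apply: cS.
Qed.

Section ShortExact.
Variables (S S' T : {set 'I_n} -> bool).
Hypothesis S_convex : convex S.
Hypothesis S_split : forall F, S F = S' F || T F.
Hypothesis ST_disj : forall F, S' F -> ~~ T F.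
Hypothesis T_up : forall F j, S F -> T (F :\ j) -> T F.

Let sS' F : S' F -> S F. Proof. by rewrite S_split => ->. Qed.
Let sT F : T F -> S F. Proof. by rewrite S_split orbC => ->. Qed.
Let S'_down F j : S' F -> S (F :\ j) -> S' (F :\ j).
Proof.
move=> S'F; rewrite S_split => /orP[//|TFj].
by have := ST_disj S'F; rewrite (T_up (sS' S'F) TFj).
Qed.
Let T_d0 c F : supported T c -> S' F -> simplex_d c F = 0.
Proof.
move=> sc S'F; apply: simplex_d_eq0 => j jF; apply: sc.
by apply: contra (ST_disj S'F); apply: T_up; apply: sS'.
Qed.
Let supp_sub (U : {set 'I_n} -> bool) c :
  (forall F, U F -> S F) -> supported U c -> supported S c.
Proof. by move=> sub sc F NS; apply: sc; apply: contra NS; apply: sub. Qed.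

(** T being closed upwards in S, functions on T are a subcomplex of those on S,
    with the functions on S' as quotient. A cocycle c on S restricts to a
    coboundary db on S', and then c - db lives on T in degree i. *)
Lemma acyclic_middle i : acyclic T i -> acyclic S' i -> acyclic S i.
Proof.
move=> acT acS' c sc cc.
have [F S'F Fi|b sb eb] := acS' (truncate S' c) (truncate_supported _).
  rewrite -[RHS](cc F (sS' S'F) Fi); apply: eq_simplex_d => j jF.
  rewrite /truncate; case: ifPn => // NS'; rewrite sc //.
  by apply: contra NS'; apply: S'_down.
have {}eb F : S' F -> #|F| = i -> c F = simplex_d b F.
  by move=> S'F Fi; rewrite -eb // truncateT.
pose c' F := c F - truncate S (simplex_d b) F.
have sbS := supp_sub sS' sb.
have [F TF Fi|g sg eg] := acT (truncate T c') (truncate_supported _).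
  have SF := sT TF.
  transitivity (simplex_d c' F); last first.
    by rewrite simplex_dB cc // simplex_d_truncate ?subr0.
  apply: eq_simplex_d => j jF; rewrite [LHS]/truncate; case: ifPn => // NT.
  rewrite /c'; case SFj: (S (F :\ j)); last first.
    by rewrite sc ?truncate_supported ?subrr ?SFj.
  have S'Fj : S' (F :\ j) by move: SFj; rewrite S_split (negbTE NT) orbF.
  rewrite truncateT // eb ?subrr //.
  by move: Fi; rewrite (cardsD1 j) jF => -[].
exists (fun F => b F + g F) => [F NS|F SF Fi].
  by rewrite sbS // (supp_sub sT sg) // addr0.
rewrite simplex_dD; move: (SF); rewrite S_split => /orP[S'F|TF].
  by rewrite (T_d0 sg) // addr0 eb.
by rewrite -eg // truncateT // /c' truncateT // addrC subrK.
Qed.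

(** The connecting map: a cocycle c on S', extended by zero to S, has its
    differential on T. If that is dg with g on T, then c - g is a cocycle on S,
    and it restricts to c on S'. *)
Lemma acyclic_quotient i : acyclic S i -> acyclic T i.+1 -> acyclic S' i.
Proof.
move=> acS acT c sc cc.
have scS := supp_sub sS' sc.
have [F TF Fi|g sg eg] :=
    acT (truncate T (simplex_d c)) (truncate_supported _).
  have SF := sT TF; rewrite -(simplex_dd c F).
  apply: eq_simplex_d => j jF; rewrite /truncate; case: ifPn => // NT.
  have Fij : #|F :\ j| = i.+1 by move: Fi; rewrite (cardsD1 j) jF => -[].
  case SFj: (S (F :\ j)).
    by rewrite cc //; move: SFj; rewrite S_split (negbTE NT) orbF.
  rewrite simplex_d_eq0 // => l _; apply: scS.
  by apply/negP => /(S_convex SF); rewrite SFj.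
have sgS := supp_sub sT sg.
have [F NS|F SF Fi|b sb eb] := acS (fun F => c F - g F).
- by rewrite scS // sgS // subr0.
- rewrite simplex_dB; move: (SF); rewrite S_split => /orP[S'F|TF].
    by rewrite cc // (T_d0 sg) ?subr0.
  by rewrite -eg // truncateT ?subrr.
exists (truncate S' b) => [|F S'F Fi]; first exact: truncate_supported.
have := eb F (sS' S'F) Fi; rewrite sg ?subr0; last exact: ST_disj.
move=> ->; apply: eq_simplex_d => j jF; rewrite /truncate.
case: ifPn => // NS'; apply: sb; apply: contra NS'; exact: S'_down.
Qed.

End ShortExact.
End SimplexComplex.

(** * Ideals spanned by monomials *)

Section MonomialClosed.
Variables (n : nat) (k : fieldType).
Implicit Types (I : ideal {mpoly k[n]}) (g : {mpoly k[n]}).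
Implicit Types (u v w m : 'X_{1..n}).

Lemma mcoeffMX_if g m w :
  (g * 'X_[m])@_w = if (m <= w)%MM then g@_(w - m) else 0.
Proof.
case: ifPn => [/submK {1}<-|nle]; first by rewrite addmC mcoeffMX.
apply/eqP; rewrite mcoeff_eq0 (perm_mem (msuppMX _ _)).
by apply: contra nle => /mapP[v _ ->]; apply: lem_addr.
Qed.

(** The form in which monomiality is used: it passes to I : f and (I, f)
    without choosing generators of these. *)
Definition monomial_closed I := forall g w, g \in I -> g@_w != 0 -> 'X_[w] \in I.

Lemma monomial_up I m w : 'X_[m] \in I -> (m <= w)%MM -> 'X_[w] \in I.
Proof. by move=> Im /submK <-; rewrite mpolyXD; apply: ideal_mulr. Qed.

Lemma monomial_ideal_closed I : monomial_ideal I -> monomial_closed I.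
Proof.
move=> [A genI] g w /genI[s [sA ->]]; apply: contraR => nIw.
rewrite raddf_sum big_seq big1 //= => p /sA[m Am ->].
rewrite mcoeffMX_if; case: ifPn => // le_mw; case/negP: nIw.
apply: monomial_up le_mw; apply/genI; exists [:: (1, 'X_[m])].
split=> [q|]; last by rewrite big_seq1 mul1r.
by rewrite inE => /eqP->; exists m.
Qed.

Lemma colonX I m w : ('X_[w] \in colon I 'X_[m]) = ('X_[w + m] \in I).
Proof. by rewrite mpolyXD. Qed.

Lemma colon_closed I m : monomial_closed I -> monomial_closed (colon I 'X_[m]).
Proof.
move=> cI g w Ig nz; rewrite colonX; apply: cI Ig _.
by rewrite addmC mcoeffMX.
Qed.

Lemma adjoinX I m w : monomial_closed I ->
  ('X_[w] \in adjoin I 'X_[m]) = ('X_[w] \in I) || (m <= w)%MM.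
Proof.
move=> cI; apply/idP/orP => [/asboolP[h Ih [r e]]|[Iw|le_mw]].
- have := congr1 (mcoeff w) e; rewrite mcoeffX eqxx mcoeffD mcoeffMX_if.
  case: (_ <= _)%MM; first by right.
  by rewrite addr0 => e1; left; apply: cI Ih _; rewrite -e1 oner_neq0.
- by apply/asboolP; exists 'X_[w] => //; exists 0; rewrite mul0r addr0.
- apply/asboolP; exists 0; first exact: rpred0.
  by exists 'X_[w - m]; rewrite add0r -mpolyXD submK.
Qed.

Lemma adjoin_closed I m : monomial_closed I -> monomial_closed (adjoin I 'X_[m]).
Proof.
move=> cI g w /asboolP[h Ih [r ->]]; rewrite adjoinX // mcoeffD mcoeffMX_if.
case: (_ <= _)%MM; rewrite ?orbT // addr0 orbF; exact: cI.
Qed.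

End MonomialClosed.

(** * Fractions with a fixed denominator *)

Section LocMap.
Variables (R : comNzRingType) (M : lmodType R) (g : R).

Lemma loc_pi_eq0 (m : M) s t : g ^+ t *: m = 0 -> \pi_(loc M g) (m, s) = 0.
Proof. by move=> e; apply/loc_eqP/asboolP; exists t; rewrite /= addn0 e scaler0. Qed.

Lemma loc_pi_expand (m : M) s t :
  \pi_(loc M g) (m, s) = \pi_(loc M g) (g ^+ t *: m, (s + t)%N).
Proof.
by apply/loc_eqP/asboolP; exists 0%N; rewrite /= !add0n scalerA -exprD.
Qed.

Lemma loc_pi_sameD (m m' : M) s :
  \pi_(loc M g) (m + m', s) = \pi_(loc M g) (m, s) + \pi_(loc M g) (m', s).
Proof. by rewrite loc_piD /frac_add /= -scalerDr -loc_pi_expand. Qed.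

Lemma loc_mapD (g' h : R) (x y : loc M g) : g' = h * g ->
  loc_map g' h (x + y) = loc_map g' h x + loc_map g' h y.
Proof.
move=> eg; elim/quotW: x => -[m s]; elim/quotW: y => -[m' s'].
rewrite loc_piD !loc_mapE // loc_piD /frac_add /=.
congr \pi_(_); congr (_, _); rewrite scalerDr !scalerA eg.
by congr (_ *: _ + _ *: _); rewrite exprD exprMn; ring.
Qed.

Lemma loc_map0 (g' h : R) : g' = h * g -> loc_map g' h (0 : loc M g) = 0.
Proof.
move=> eg; rewrite [0 in LHS](erefl (\pi_(loc M g) (0, 0%N))).
by rewrite loc_mapE // scaler0.
Qed.

Lemma loc_map_sum (T : Type) (r : seq T) (x : T -> loc M g) (g' h : R) :
  g' = h * g ->
  loc_map g' h (\sum_(t <- r) x t) = \sum_(t <- r) loc_map g' h (x t).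
Proof.
move=> eg; elim: r => [|t r IH]; first by rewrite !big_nil loc_map0.
by rewrite !big_cons loc_mapD // IH.
Qed.
End LocMap.

(** * The multigraded parts of the Cech complex *)

Section CechDegree.
Variables (n : nat) (k : fieldType) (I : ideal {mpoly k[n]}).
Hypothesis cI : monomial_closed I.
Local Notation Q := (quotmod I).
Implicit Types (F G : {set 'I_n}) (j l : 'I_n) (u v w m : 'X_{1..n}).
Implicit Types (N s t : nat) (a : k).

Definition set_mnm F s : 'X_{1..n} := [multinom if j \in F then s else 0%N | j < n].

Lemma xprodX F s : xprod k F ^+ s = 'X_[set_mnm F s].
Proof.
rewrite /xprod mprodXE mpolyXn; congr 'X_[_]; apply/mnmP=> j.
rewrite mulmnE mnm_sumE mnmE; case: ifPn => jF.
  rewrite (bigD1 j) //= mnm1E eqxx big1 ?mul1n //= => l /andP[_ /negbTE lj].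
  by rewrite mnm1E lj.
rewrite big1 // => l lF; rewrite mnm1E; case: eqP => // lj.
by rewrite -lj lF in jF.
Qed.

Lemma xprod_D1 F j : j \in F -> xprod k F = 'X_j * xprod k (F :\ j).
Proof. exact: big_setD1. Qed.

Lemma quotmod_scaleE g h : g *: (\pi_Q h : Q) = \pi_Q (g * h).
Proof. exact: quotmod_pi_scale. Qed.

(** Meaningful only when 'X_[w] is outside I; the value 0 otherwise makes it
    additive for every w. *)
Definition quotmod_coef w (x : Q) : k := if 'X_[w] \in I then 0 else (repr x)@_w.

Lemma quotmod_coef_pi w g : 'X_[w] \notin I -> quotmod_coef w (\pi_Q g) = g@_w.
Proof.
move=> nIw; rewrite /quotmod_coef (negbTE nIw); apply/eqP; rewrite -subr_eq0 -mcoeffB.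
apply: contraR nIw; apply: cI; apply/quotmod_eqP; exact: reprK.
Qed.

Lemma quotmod_coefD w x y : quotmod_coef w (x + y) = quotmod_coef w x + quotmod_coef w y.
Proof.
case Iw: ('X_[w] \in I); first by rewrite /quotmod_coef Iw addr0.
elim/quotW: x => x; elim/quotW: y => y.
by rewrite -quotmod_piD !quotmod_coef_pi ?Iw // mcoeffD.
Qed.

Lemma quotmod_coefZX w m x : 'X_[w + m] \notin I ->
  quotmod_coef (w + m) ('X_[m] *: x) = quotmod_coef w x.
Proof.
move=> nI; have nIw : 'X_[w] \notin I.
  by apply: contra nI => /monomial_up; apply; apply: lem_addr.
elim/quotW: x => x; rewrite quotmod_scaleE !quotmod_coef_pi //.
by rewrite mulrC addmC mcoeffMX.
Qed.

(** The faces F at which R/I, localized at x_F, is nonzero in degree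
    a = u - N(1,...,1): multiplying x^a by powers of x_F gives multiples of every
    monomial that agrees with a off F, so none of these may be in I. *)
Definition degree_support u N F : bool :=
  `[< (forall j, j \notin F -> (N <= u j)%N) /\
      forall v, (forall j, j \notin F -> v j = u j - N)%N -> 'X_[v] \notin I >].

(** The exponent of x^a * x_F^(N + s), which is a genuine monomial as soon as
    a >= 0 off F. *)
Definition shift_mnm u N F s : 'X_{1..n} :=
  [multinom if j \in F then u j + s else u j - N | j < n]%N.

Section Degree.
Variables (u : 'X_{1..n}) (N : nat).
Local Notation S := (degree_support u N).
Local Notation shift := (shift_mnm u N).

Lemma shift_notin F s : S F -> 'X_[shift F s] \notin I.
Proof. by case/asboolP=> _; apply=> j /negbTE jF; rewrite mnmE jF. Qed.

Lemma shiftD F s t : shift F (s + t) = (shift F s + set_mnm F t)%MM.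
Proof. by apply/mnmP=> j; rewrite !mnmE; case: ifP => _; lia. Qed.

Lemma degree_support_ge F j : S F -> j \notin F -> (N <= u j)%N.
Proof. by case/asboolP=> + _; apply. Qed.

(** A monomial that agrees with the degree off F :\ j also does so off F, so the
    condition on I at F contains the one at F :\ j: only the sign condition is
    left to decide whether F :\ j is in the family. *)
Lemma degree_support_D1 F j : S F -> S (F :\ j) = (j \in F) ==> (N <= u j)%N.
Proof.
move=> SF; apply/idP/implyP => [SFj jF|H].
  by apply: degree_support_ge SFj _; rewrite !inE eqxx.
case/asboolP: SF => ge nI; apply/asboolP; split=> [l|v ev].
  rewrite !inE negb_and negbK => /orP[/eqP->|/ge//].
  by case: (boolP (j \in F)) => [/H|/ge].
by apply: nI => l lF; apply: ev; rewrite !inE negb_and lF orbT.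
Qed.

(** The coefficient of x^a in a fraction y / x_F^s is that of x^a * x_F^(N + s)
    in x_F^N y; the extra factor x_F^N keeps the exponents nonnegative whatever
    the denominator. *)
Definition cech_coef F (x : loc Q (xprod k F)) : k :=
  if S F then quotmod_coef (shift F (repr x).2) (xprod k F ^+ N *: (repr x).1) else 0.

Lemma quotmod_coef_expand F s t x : S F ->
  quotmod_coef (shift F (s + t)) (xprod k F ^+ t *: x) = quotmod_coef (shift F s) x.
Proof. by move=> SF; rewrite xprodX shiftD quotmod_coefZX // -shiftD shift_notin. Qed.

Lemma cech_coefE F (x : Q) s : S F ->
  cech_coef (\pi_(loc Q (xprod k F)) (x, s)) =
    quotmod_coef (shift F s) (xprod k F ^+ N *: x).
Proof.
move=> SF; rewrite /cech_coef SF; case: (loc_repr (xprod k F) (x, s)) => t.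
case: (repr _) => y r /= e.
rewrite -(quotmod_coef_expand _ (t + s) _ SF) -[RHS](quotmod_coef_expand _ (t + r) _ SF).
rewrite !scalerA -!exprD (e _ (t + r + N)%N); [|lia|lia].
by congr (quotmod_coef (shift F _) _); lia.
Qed.

Lemma cech_coef_out F x : ~~ S F -> @cech_coef F x = 0.
Proof. by rewrite /cech_coef => /negbTE->. Qed.

Fact cech_coef_additive F : {morph @cech_coef F : x y / x - y}.
Proof.
have lD : {morph @cech_coef F : x y / x + y}.
  move=> x y; case SF: (S F); last by rewrite !cech_coef_out ?SF ?addr0.
  elim/quotW: x => -[x s]; elim/quotW: y => -[y t].
  rewrite loc_piD !cech_coefE // scalerDr quotmod_coefD /=.
  rewrite !scalerA !(mulrC (_ ^+ N)) -!scalerA.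
  by rewrite quotmod_coef_expand // addnC quotmod_coef_expand.
by move=> x y; apply/eqP; rewrite eq_sym subr_eq -lD subrK.
Qed.
HB.instance Definition _ F :=
  GRing.isZmodMorphism.Build _ _ (@cech_coef F) (@cech_coef_additive F).

(** For F in the family, the homogeneous fraction of degree u - N with
    coefficient a, written with denominator x_F^N. *)
Definition cech_term F a : loc Q (xprod k F) :=
  \pi_(loc Q (xprod k F)) (\pi_Q (a *: 'X_[shift F 0]), N).

Fact cech_term_additive F : {morph cech_term F : x y / x - y}.
Proof.
have lD : {morph cech_term F : x y / x + y}.
  by move=> x y; rewrite /cech_term -loc_pi_sameD -quotmod_piD scalerDl.
by move=> x y; apply/eqP; rewrite eq_sym subr_eq -lD subrK.
Qed.
HB.instance Definition _ F :=
  GRing.isZmodMorphism.Build _ _ (cech_term F) (@cech_term_additive F).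

Lemma cech_coef_term F a : S F -> cech_coef (cech_term F a) = a.
Proof.
move=> SF; rewrite cech_coefE // -[N in shift F N]add0n quotmod_coef_expand //.
by rewrite quotmod_coef_pi ?shift_notin // mcoeffZ mcoeffX eqxx mulr1.
Qed.

(** When F :\ j is outside the family, u_j < N, so that no fraction coming from
    the localization at x_(F :\ j) has a term of the required degree. *)
Lemma cech_coef_map F j (x : loc Q (xprod k (F :\ j))) : S F -> j \in F ->
  cech_coef (loc_map (xprod k F) 'X_j x) = cech_coef x.
Proof.
move=> SF jF; elim/quotW: x => -[x s]; rewrite (loc_mapE _ _ (xprod_D1 jF)) cech_coefE //.
elim/quotW: x => g; rewrite scalerA quotmod_scaleE quotmod_coef_pi ?shift_notin //.
have -> : xprod k F ^+ N * 'X_j ^+ s * g =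
    (xprod k (F :\ j) ^+ N * g) * 'X_[U_(j) *+ (N + s)].
  by rewrite (xprod_D1 jF) exprMn -mpolyXn exprD; ring.
rewrite mcoeffMX_if.
case SFj: (S (F :\ j)); move: (SFj); rewrite degree_support_D1 // jF /= => Nu.
  rewrite cech_coefE // quotmod_scaleE quotmod_coef_pi ?shift_notin //.
  have -> : shift F s = (shift (F :\ j) s + U_(j) *+ (N + s))%MM.
    apply/mnmP=> l; rewrite !(mnm1E, mnmE, mulmnE) !inE (eq_sym l).
    by case: eqP => [<-|_] /=; [rewrite jF|case: ifP]; lia.
  by rewrite lem_addl addmK.
rewrite cech_coef_out ?SFj //; case: ifPn => // /mnm_lepP/(_ j).
rewrite mulmnE mnm1E eqxx mnmE jF; lia.
Qed.

Lemma cech_term_map F j a : j \in F -> (N <= u j)%N ->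
  loc_map (xprod k F) 'X_j (cech_term (F :\ j) a) = cech_term F a.
Proof.
move=> jF Nu; rewrite (loc_mapE _ _ (xprod_D1 jF)) quotmod_scaleE -scalerAr.
rewrite mpolyXn -mpolyXD; congr (\pi_(_) (\pi_Q (_ *: 'X_[_]), _)).
apply/mnmP=> l; rewrite !(mnm1E, mnmE, mulmnE) !inE (eq_sym l).
by case: eqP => [<-|_] /=; [rewrite jF|case: ifP]; lia.
Qed.

(** If x^v is in I and agrees with the chosen degree off F, a large power of x_F
    carries x^(u - N) to a multiple of x^v. *)
Lemma cech_term_eq0 F a : (forall j, j \notin F -> (N <= u j)%N) -> ~~ S F ->
  cech_term F a = 0.
Proof.
move=> ge /asboolPn NS; have [v ev Iv] : exists2 v : 'X_{1..n},
    (forall j, j \notin F -> v j = u j - N)%N & 'X_[v] \in I.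
  apply: contra_notP NS => H; split=> // v ev.
  by apply/negP => Iv; apply: H; exists v.
apply: (loc_pi_eq0 _ (t := mdeg v)).
rewrite xprodX quotmod_scaleE -scalerAr -mpolyXD.
apply/eqP; rewrite -[0](_ : \pi_Q 0 = 0); last by rewrite piE.
apply/eqP/quotmod_eqP; rewrite subr0 -mul_mpolyC ideal_mulr //.
apply: monomial_up Iv _; apply/mnm_lepP=> j; rewrite !mnmE.
case: ifPn => [_|/ev->]; last by lia.
have : (v j <= mdeg v)%N by rewrite mdegE (bigD1 j) //= leq_addr.
lia.
Qed.

Lemma cech_coef_d F (c : cochain Q) : S F ->
  cech_coef (cech_d c F) = simplex_d (fun G => cech_coef (c G)) F.
Proof.
move=> SF; rewrite /cech_d raddf_sum; apply: eq_bigr => j jF.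
by rewrite raddfMz /= cech_coef_map.
Qed.

(** This holds for every F, in the family or not, and so it transports both the
    cocycle and the coboundary equation. *)
Lemma cech_d_term F (c : {set 'I_n} -> k) : supported S c ->
  cech_d (fun G => cech_term G (c G)) F = cech_term F (simplex_d c F).
Proof.
move=> sc; rewrite /simplex_d raddf_sum; apply: eq_bigr => j jF.
rewrite raddfMz /=; congr (_ *~ _).
case SFj: (S (F :\ j)).
  by rewrite cech_term_map //; apply: degree_support_ge SFj _; rewrite !inE eqxx.
by rewrite sc ?SFj // !raddf0 (loc_map0 _ (xprod_D1 jF)).
Qed.

Lemma cech_term_simplex_d_out F (c : {set 'I_n} -> k) :
  supported S c -> ~~ S F -> cech_term F (simplex_d c F) = 0.
Proof.
move=> sc NS.
have [ge|/existsNP[j /not_implyP[jF /negP lt]]] :=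
  pselect (forall j, j \notin F -> (N <= u j)%N); first exact: cech_term_eq0.
rewrite simplex_d_eq0 ?raddf0 // => l lF; apply: sc; apply: contra lt => SFl.
by apply: degree_support_ge SFl _; rewrite !inE negb_and jF orbT.
Qed.

End Degree.

Lemma cech_d_sum (T : Type) (r : seq T) (b : T -> cochain Q) F :
  cech_d (fun G => \sum_(t <- r) b t G) F = \sum_(t <- r) cech_d (b t) F.
Proof.
rewrite /cech_d [RHS]exchange_big /=; apply: eq_bigr => j jF.
by rewrite (loc_map_sum _ _ (xprod_D1 jF)) mulrz_suml.
Qed.

(** A fraction with denominator x_F^N is the sum of its homogeneous parts. Its
    monomials w of the numerator correspond to the u equal to w on F and to
    w + N off F. U may be larger than needed, so that one list can serve all
    faces simultaneously. *)
Lemma sum_cech_term_coef F N (g : {mpoly k[n]}) (U : seq 'X_{1..n}) :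
    uniq U ->
    (forall w, w \in msupp g -> (w + set_mnm (~: F) N)%MM \in U) ->
  \sum_(u <- U) cech_term u N F (cech_coef u N (\pi_(loc Q (xprod k F)) (\pi_Q g, N))) =
  \pi_(loc Q (xprod k F)) (\pi_Q g, N).
Proof.
move=> uU sU; set x := \pi_(loc _ _) _.
pose phi w := (w + set_mnm (~: F) N)%MM.
have phiK w : shift_mnm (phi w) N F 0 = w.
  by apply/mnmP=> j; rewrite !(mnmE, inE); case: (j \in F); rewrite /=; lia.
have phi_ge w j : j \notin F -> (N <= phi w j)%N.
  by move=> jF; rewrite !mnmE inE jF leq_addl.
have coefE u : degree_support u N F -> cech_coef u N x = g@_(shift_mnm u N F 0).
  move=> SF; rewrite /x cech_coefE // quotmod_scaleE quotmod_coef_pi ?shift_notin //.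
  by rewrite xprodX mulrC -[N in shift_mnm u N F N]add0n shiftD addmC mcoeffMX.
have termE w : cech_term (phi w) N F (cech_coef (phi w) N x) = cech_term (phi w) N F g@_w.
  case SF: (degree_support (phi w) N F); first by rewrite (coefE _ SF) (phiK w).
  by rewrite !cech_term_eq0 ?SF //; apply: phi_ge.
transitivity (\sum_(u <- [seq phi w | w <- msupp g]) cech_term u N F (cech_coef u N x)).
  rewrite (bigID (mem [seq phi w | w <- msupp g])) /= [X in _ + X]big1 ?addr0.
    rewrite -big_filter; apply: perm_big; apply: uniq_perm.
    - exact: filter_uniq.
    - by rewrite map_inj_uniq ?msupp_uniq // => w w' /addIm.
    move=> u; rewrite mem_filter; apply: andb_idr => /mapP[w wg ->]; exact: sU.
  move=> u nu; case SF: (degree_support u N F); last first.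
    by rewrite cech_coef_out ?SF // raddf0.
  rewrite coefE // memN_msupp_eq0 ?raddf0 //.
  apply: contra nu => sg; apply/mapP; exists (shift_mnm u N F 0) => //.
  apply/mnmP=> j; rewrite !(mnmE, inE); case: ifPn => jF /=; first by lia.
  by rewrite subnK //; apply: degree_support_ge SF jF.
rewrite big_map (eq_bigr (fun w => cech_term (phi w) N F g@_w)) // /x.
rewrite [in RHS](mpolyE g).
elim: (msupp g) => [|w r IH]; last first.
  by rewrite !big_cons IH /cech_term phiK -loc_pi_sameD -quotmod_piD.
by rewrite !big_nil; apply/esym; apply: (loc_pi_eq0 _ (t := 0%N));
  rewrite quotmod_scaleE mulr0 piE.
Qed.

(** Functions on the family embed into the Cech complex as its part of one degree,
    with taking coefficients as a retraction; this gives one direction. For the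
    other, a cochain has finitely many nonzero homogeneous parts once all its
    components are brought to one denominator exponent N, and the parts are
    bounded one by one. *)
Theorem cech_acyclicP i :
  (forall c : cochain Q, cocycle i c -> coboundary i c) <->
  (forall u N, acyclic k (degree_support u N) i).
Proof.
split=> [H u N c sc cc|H c cc].
  have [F Fi|b eb] := H (fun F => cech_term u N F (c F)).
    rewrite cech_d_term //; case SF: (degree_support u N F).
      by rewrite cc // raddf0.
    by rewrite cech_term_simplex_d_out ?SF.
  exists (fun F => cech_coef u N (b F)) => [F /cech_coef_out -> //|F SF Fi].
  by rewrite -cech_coef_d // -eb // cech_coef_term.
pose N := (\max_(F : {set 'I_n}) (repr (c F)).2)%N.
have [g cE] : exists g : {set 'I_n} -> {mpoly k[n]},
    forall F, c F = \pi_(loc Q (xprod k F)) (\pi_Q (g F), N).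
  exists (fun F => repr (xprod k F ^+ (N - (repr (c F)).2) *: (repr (c F)).1)) => F.
  have le : ((repr (c F)).2 <= N)%N by apply: leq_bigmax.
  rewrite reprK -[X in (_, X)](subnKC le) -loc_pi_expand -surjective_pairing.
  by apply/esym/reprK.
pose U := undup (flatten [seq [seq (w + set_mnm (~: F) N)%MM | w <- msupp (g F)]
                         | F : {set 'I_n}]).
have cU F : \sum_(u <- U) cech_term u N F (cech_coef u N (c F)) = c F.
  rewrite cE; apply: sum_cech_term_coef; first exact: undup_uniq.
  move=> w wg; rewrite mem_undup; apply/flatten_mapP; exists F.
    by rewrite mem_enum.
  by apply/mapP; exists w.
have /choice[b bP] : forall u, exists b : {set 'I_n} -> k,
    supported (degree_support u N) b /\
    forall F, degree_support u N F -> #|F| = i ->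
      cech_coef u N (c F) = simplex_d b F.
  move=> u; have [F /cech_coef_out//|F SF Fi|b sb eb] :=
    H u N (fun F => cech_coef u N (c F)).
    by rewrite -cech_coef_d // cc // raddf0.
  by exists b.
exists (fun F => \sum_(u <- U) cech_term u N F (b u F)) => F Fi.
rewrite cech_d_sum -[LHS]cU; apply: eq_bigr => u _; have [sb eb] := bP u.
rewrite cech_d_term //; case SF: (degree_support u N F); first by rewrite eb.
by rewrite cech_coef_out ?SF // raddf0 cech_term_simplex_d_out ?SF.
Qed.

End CechDegree.

(** * Families of faces of the three ideals *)

Section ColonAdjoin.
Variables (n : nat) (k : fieldType) (I : ideal {mpoly k[n]}) (m : 'X_{1..n}).
Hypothesis cI : monomial_closed I.
Implicit Types (F : {set 'I_n}) (j : 'I_n) (u v : 'X_{1..n}).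
Local Notation J := (colon I 'X_[m]).
Local Notation L := (adjoin I 'X_[m]).

Let splice F v w : 'X_{1..n} := [multinom if j \in F then v j else w j | j < n].

(** Adding deg f where the degree is nonnegative turns a test monomial v for J
    into v f for I; on F the exponents are free, and I is closed under
    multiples. Where the degree is negative it is left unchanged, as adding
    deg f there could make it nonnegative. *)
Lemma colon_degree_support u N :
  degree_support J u N =1
  degree_support I [multinom if (N <= u j)%N then (u j + m j)%N else u j | j < n] N.
Proof.
move=> F; apply/asboolP/asboolP => -[ge nI].
  split=> [j jF|v ev]; first by rewrite mnmE; case: ifP => // _; have := ge j jF; lia.
  apply: contra (nI (splice F v (u - [multinom N | _ < n])%MM) _).
    move=> Iv; rewrite colonX; apply: monomial_up Iv _; apply/mnm_lepP=> j.
    rewrite !mnmE; case: ifPn => jF; first exact: leq_addr.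
    by rewrite ev // !mnmE ge //; have := ge j jF; lia.
  by move=> j /negbTE jF; rewrite !mnmE jF.
have {}ge j : j \notin F -> (N <= u j)%N.
  by move=> /ge; rewrite mnmE; case: ifPn => // /negbTE->.
split=> // v ev; rewrite colonX; apply: nI => j jF.
by rewrite !mnmE ev // ge //; have := ge j jF; lia.
Qed.

Let M := mdeg m.
Let le_mM j : (m j <= M)%N.
Proof. by rewrite /M mdegE (bigD1 j) //= leq_addr. Qed.

(** Together with N + M in place of N, this is the degree u - N - m, with
    M = mdeg m chosen to keep the exponents nonnegative. *)
Definition colon_degree u : 'X_{1..n} := [multinom (u j + (M - m j))%N | j < n].

(** The faces at which x^a is a multiple of f in the localization of R/I. *)
Lemma colon_degree_supportE u N F :
  degree_support J (colon_degree u) (N + M) F =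
  degree_support I u N F && [forall j in ~: F, (N + m j <= u j)%N].
Proof.
apply/asboolP/andP => -[].
  move=> ge nI; have {}ge j : j \notin F -> (N + m j <= u j)%N.
    by move=> /ge; rewrite mnmE; have := le_mM j; lia.
  split; last by apply/'forall_implyP => j; rewrite inE; apply: ge.
  apply/asboolP; split=> [j /ge|v ev]; first by lia.
  apply: contra (nI (splice F v (u - [multinom N + m j | j < n])%MM) _).
    move=> Iv; rewrite colonX; apply: monomial_up Iv _; apply/mnm_lepP=> j.
    rewrite !mnmE; case: ifPn => jF; first exact: leq_addr.
    by rewrite ev //; have := ge j jF; lia.
  move=> j jF; rewrite !mnmE (negbTE jF); have := le_mM j; have := ge j jF; lia.
case/asboolP => ge nI /'forall_implyP gem.
have {}gem j : j \notin F -> (N + m j <= u j)%N by move=> jF; apply: gem; rewrite inE.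
split=> [j jF|v ev]; first by rewrite mnmE; have := le_mM j; have := gem j jF; lia.
rewrite colonX; apply: nI => j jF; rewrite mnmE ev // mnmE.
by have := le_mM j; have := gem j jF; lia.
Qed.

Lemma adjoin_degree_supportE u N F :
  degree_support L u N F =
  degree_support I u N F && ~~ [forall j in ~: F, (N + m j <= u j)%N].
Proof.
apply/asboolP/andP => -[].
  move=> ge nI; split.
    apply/asboolP; split=> // v ev; apply: contra (nI v ev).
    by rewrite adjoinX // => ->.
  apply/negP => /'forall_implyP gem.
  have := nI (splice F m (u - [multinom N | _ < n])%MM) _.
  rewrite adjoinX // negb_or => /(_ _)/andP[].
    by move=> j /negbTE jF; rewrite !mnmE jF.
  move=> _ /negP; apply; apply/mnm_lepP => j; rewrite !mnmE.
  by case: ifPn => // jF; have := gem j; rewrite inE => /(_ jF); lia.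
case/asboolP => ge nI /negP ngem; split=> // v ev.
rewrite adjoinX // (negbTE (nI v ev)) /=; apply/negP => /mnm_lepP le_mv.
apply: ngem; apply/'forall_implyP => j; rewrite inE => jF.
by have := le_mv j; have := ge j jF; rewrite ev //; lia.
Qed.

Lemma degree_support_convex u N : convex (degree_support I u N).
Proof.
move=> F j l SF SFjl; rewrite degree_support_D1 //; apply/implyP => _.
by apply: degree_support_ge SFjl _; rewrite !inE eqxx andbF.
Qed.

Lemma colon_degree_support_up u N F j : degree_support I u N F ->
  degree_support J (colon_degree u) (N + M) (F :\ j) ->
  degree_support J (colon_degree u) (N + M) F.
Proof.
rewrite !colon_degree_supportE => -> /andP[_ /'forall_implyP ge] /=.
apply/'forall_implyP => l; rewrite inE => lF; apply: ge.
by rewrite !inE negb_and lF orbT.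
Qed.

Definition vanishing (I' : ideal {mpoly k[n]}) i :=
  forall c : cochain (quotmod I'), cocycle i c -> coboundary i c.

Let cJ : monomial_closed J := colon_closed (m := m) cI.
Let cL : monomial_closed L := adjoin_closed (m := m) cI.

Lemma vanishing_colon i : vanishing I i -> vanishing J i.
Proof.
move=> /(cech_acyclicP cI) H; apply/(cech_acyclicP cJ) => u N.
by apply: eq_acyclic (H _ N) => F; rewrite [RHS]colon_degree_support.
Qed.

Lemma support_split u N F : degree_support I u N F =
  degree_support L u N F || degree_support J (colon_degree u) (N + M) F.
Proof.
by rewrite colon_degree_supportE adjoin_degree_supportE -andb_orr orNb andbT.
Qed.

Lemma support_disjoint u N F : degree_support L u N F ->
  ~~ degree_support J (colon_degree u) (N + M) F.
Proof.
by rewrite colon_degree_supportE adjoin_degree_supportE => /andP[-> /negbTE->].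
Qed.

Lemma vanishing_middle i : vanishing J i -> vanishing L i -> vanishing I i.
Proof.
move=> /(cech_acyclicP cJ) HJ /(cech_acyclicP cL) HL; apply/(cech_acyclicP cI) => u N.
apply: (acyclic_middle _ _ _ _ (HJ (colon_degree u) (N + M)%N) (HL u N)).
- exact: degree_support_convex.
- exact: support_split.
- exact: support_disjoint.
- exact: colon_degree_support_up.
Qed.

Lemma vanishing_adjoin i : vanishing I i -> vanishing J i.+1 -> vanishing L i.
Proof.
move=> /(cech_acyclicP cI) HI /(cech_acyclicP cJ) HJ; apply/(cech_acyclicP cL) => u N.
apply: (acyclic_quotient _ _ _ _ (HI u N) (HJ (colon_degree u) (N + M)%N)).
- exact: degree_support_convex.
- exact: support_split.
- exact: support_disjoint.
- exact: colon_degree_support_up.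
Qed.

End ColonAdjoin.

(** * Depth as the first nonvanishing degree *)

Variant first_failure (P : nat -> Prop) : option nat -> Prop :=
| FirstFailureAt d of ~ P d & (forall e, (e < d)%N -> P e) :
    first_failure P (Some d)
| NoFailure of (forall e, P e) : first_failure P None.

(** If P first fails at b and Q holds up to b, then R fails at b, for otherwise P
    would hold there; and R holds before b by the last hypothesis, where Q is
    needed up to b only. So R first fails at b as well. *)
Lemma first_failure_colon (P Q R : nat -> Prop) dP dQ dR :
    first_failure P dP -> first_failure Q dQ -> first_failure R dR ->
    (forall i, P i -> Q i) -> (forall i, Q i -> R i -> P i) ->
    (forall i, P i -> Q i.+1 -> R i) ->
  (dP = dQ \/ dP = dR) /\ (depth_le dQ dR -> dP = dQ).
Proof.
move=> fP fQ fR PQ QRP PQR.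
suff [->|[-> nle]] : dP = dQ \/ dP = dR /\ ~ depth_le dQ dR.
- by split; [left|].
- by split=> [|/nle//]; right.
have lt_case b : ~ P b -> (forall e, (e < b)%N -> P e) ->
    (forall e, (e <= b)%N -> Q e) -> dR = Some b.
  move=> nP aP aQ; have nR : ~ R b by move=> rb; apply/nP/QRP => //; apply: aQ.
  have aR e : (e < b)%N -> R e by move=> lt_eb; apply: PQR; [apply: aP|apply: aQ].
  case: fR => [c nRc aRc|/(_ b)//].
  by congr Some; case: (ltngtP c b) => // [/aR//|/aRc//].
case: fP => [b nP aP|aP]; last first.
  by case: fQ => [a nQ _|_]; [case: nQ; apply/PQ|left].
case: fQ => [a nQ aQ|aQ].
  have [lt_ab|lt_ba|->] := ltngtP a b; last by left.
    by case: nQ; apply/PQ/aP.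
  rewrite (lt_case b) //; last by move=> e le_eb; apply: aQ; apply: leq_ltn_trans lt_ba.
  by right; split=> //=; apply/negP; rewrite -ltnNge.
by rewrite (lt_case b) //; right; split=> /=.
Qed.

Lemma depth_first_failure (n : nat) (k : fieldType) (I : ideal {mpoly k[n]}) :
  first_failure (vanishing I) (depth (quotmod I)).
Proof.
have neq0P i : local_cohomology_neq0 (quotmod I) i <-> ~ vanishing I i.
  split=> [[c [cc nb]] H|H]; first exact/nb/H.
  apply: contra_notP H => H c cc; apply: contrapT => nb; apply: H.
  by exists c.
rewrite /depth; case: pselect => [H|H]; last first.
  right=> e; apply: contrapT => /neq0P He; apply: H.
  by exists e; apply/asboolP.
case: ex_minnP => d /asboolP/neq0P nd mind; left=> // e.
move=> lt_ed; apply: contrapT => /neq0P He.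
by have := mind e (introT (asboolP _) He); rewrite leqNgt lt_ed.
Qed.

Theorem theorem4p3 (k : fieldType) (n : nat) (I : ideal {mpoly k[n]})
    (hI : monomial_ideal I) (m : 'X_{1..n}) :
  let f : {mpoly k[n]} := 'X_[m] in
  (depth (quotmod I) = depth (quotmod (colon I f)) \/
   depth (quotmod I) = depth (quotmod (adjoin I f))) /\
  (depth_le (depth (quotmod (colon I f))) (depth (quotmod (adjoin I f))) ->
   depth (quotmod I) = depth (quotmod (colon I f))).
Proof.
move=> f; have cI := monomial_ideal_closed hI.
exact: (first_failure_colon (depth_first_failure I)
  (depth_first_failure (colon I f)) (depth_first_failure (adjoin I f))
  (@vanishing_colon _ _ _ m cI) (@vanishing_middle _ _ _ m cI)
  (@vanishing_adjoin _ _ _ m cI)).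
Qed.
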